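(* Let $\mathcal{D}:=\{\rho\in\mathbb{H}_+ \mid \operatorname{trace}(\rho)=1\}$ and let $\rho\in\mathcal{D}$. Then the tangent space $T_\rho$ of $\mathcal{D}$ at $\rho$ decomposes as the direct sum $$T_\rho = R_\rho\oplus C_\rho$$ of the orthogonal components $$R_\rho=\{[X,\rho]\mid X\in\mathbb{S}\},\qquad C_\rho=\{u \mid u\in\mathbb{H},\ [u,\rho]=0,\ \text{and } \operatorname{trace}(u)=0\}.$$ Moreover, let $\rho(\cdot)$ be a differentiable path in $\mathbb{H}_+$, defined on a time interval, that satisfies $$\dot\rho(t)=[X(t),\rho(t)]+u(t).$$ If $X(t)\in\mathbb{S}$ and $u(t)\in C_{\rho(t)}$ for all $t$, then $\operatorname{trace}(\rho(t))$ remains constant with $t$.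
   Context: Fix $n\ge 1$; all matrices are complex $n\times n$ matrices. $\mathbb{H}$ denotes the set of Hermitian matrices, $\mathbb{S}$ the set of skew-Hermitian matrices, and $\mathbb{H}_+$ the cone of positive-semidefinite Hermitian matrices. The commutator is $[A,B]:=AB-BA$. The tangent space of $\mathbb{H}_+$ at any point $\rho\in\mathbb{H}_+$ is taken to be the real vector space $\mathbb{H}$ (also at boundary points); accordingly, the tangent space of $\mathcal{D}$ at $\rho\in\mathcal{D}$ is $T_\rho=\{v\in\mathbb{H}\mid \operatorname{trace}(v)=0\}$. Orthogonality is with respect to the real inner product $\langle A,B\rangle=\operatorname{trace}(AB)$ on $\mathbb{H}$. The sets $R_\rho$ and $C_\rho$ are defined by the same formulas for every $\rho\in\mathbb{H}_+$. *)

(* Defs.v *)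
From HB Require Import structures.
From mathcomp Require Import all_boot all_order all_algebra sesquilinear spectral.
From mathcomp Require Import complex.
From mathcomp Require Import boolp classical_sets reals topology normedtype.

Set Implicit Arguments.
Unset Strict Implicit.
Unset Printing Implicit Defensive.

Import Order.TTheory GRing.Theory Num.Theory.
Import numFieldNormedType.Exports.

Local Open Scope ring_scope.
Local Open Scope complex_scope.
Local Open Scope sesquilinear_scope.
Local Open Scope classical_set_scope.

Definition commutator_mx (R : realType) (n : nat) (A B : 'M[R[i]]_n) : 'M[R[i]]_n :=
  A *m B - B *m A.

Definition Herm (R : realType) (n : nat) : set 'M[R[i]]_n :=
  [set A | A \is hermsymmx].

(* The sign flag [true] makes this A = - A^t*. *)
Definition skewHerm (R : realType) (n : nat) : set 'M[R[i]]_n :=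
  [set A | A \is hermitianmx n true Num.conj].

(* In R[i], [0 <= z] says that z is real and nonnegative. *)
Definition HermPos (R : realType) (n : nat) : set 'M[R[i]]_n :=
  [set A | Herm A /\
           forall v : 'cV[R[i]]_n, 0 <= (v ^t* *m A *m v) ord0 ord0].

Definition density (R : realType) (n : nat) : set 'M[R[i]]_n :=
  [set rho | HermPos rho /\ \tr rho = 1].

(* The tangent space of the cone [HermPos] is taken to be all of [Herm], also
   at boundary points; hence this space does not depend on the base point. *)
Definition tangent (R : realType) (n : nat) (rho : 'M[R[i]]_n) :
    set 'M[R[i]]_n :=
  [set v | Herm v /\ \tr v = 0].

Definition Rspace (R : realType) (n : nat) (rho : 'M[R[i]]_n) :
    set 'M[R[i]]_n :=
  [set commutator_mx X rho | X in @skewHerm R n].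

Definition Cspace (R : realType) (n : nat) (rho : 'M[R[i]]_n) :
    set 'M[R[i]]_n :=
  [set u | [/\ Herm u, commutator_mx u rho = 0 & \tr u = 0]].

(* Complex matrices carry no R-module structure in the library: real scalars
   act through the embedding R -> R[i]. *)
Definition real_subspace (R : realType) (n : nat) (V : set 'M[R[i]]_n) : Prop :=
  V 0 /\ forall (a : R) A B, V A -> V B -> V (a%:C *: A + B).

Definition direct_sum (R : realType) (n : nat) (V W1 W2 : set 'M[R[i]]_n) : Prop :=
  [/\ real_subspace W1, real_subspace W2,
      V = [set A + B | A in W1 & B in W2] & W1 `&` W2 = [set 0]].

(* The inner product trace(AB) is R[i]-valued here; it is real on [Herm]. *)
Definition inner_mx (R : realType) (n : nat) (A B : 'M[R[i]]_n) : R[i] :=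
  \tr (A *m B).

Definition orthogonal_sets (R : realType) (n : nat) (W1 W2 : set 'M[R[i]]_n) : Prop :=
  forall A B, W1 A -> W2 B -> inner_mx A B = 0.

(* Derivative relative to the interval I, so one-sided at an endpoint of I
   that belongs to I. The library puts the topology of the norm of R[i] on the
   alias R[i]^o. *)
Definition has_derivative_in (R : realType) (n : nat) (I : interval R)
    (rho : R -> 'M[R[i]]_n) (t : R) (v : 'M[R[i]]_n) : Prop :=
  (fun s : R => ((s - t)^-1)%:C *: (rho s - rho t) : 'M[R[i]^o]_n) @
    within [set` I] t^' --> (v : 'M[R[i]^o]_n).

(* Main.v *)
(* Since trace(AB) is invariant under cyclic permutations, C_rho is orthogonal
   to R_rho, so the two meet only in 0. Diagonalizing the Hermitian matrix rho
   splits a Hermitian v explicitly as [X, rho] + u. Along the path the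
   derivative has trace 0, and the trace, which is real, is constant by the mean
   value theorem. *)
Require Import Defs.
From mathcomp Require Import all_boot all_order all_algebra sesquilinear spectral.
From mathcomp Require Import complex.
From mathcomp Require Import boolp classical_sets reals topology function_spaces normedtype derive.

Set Implicit Arguments.
Unset Strict Implicit.
Unset Printing Implicit Defensive.

Import Order.TTheory GRing.Theory Num.Theory.
Import numFieldNormedType.Exports.

Local Open Scope ring_scope.
Local Open Scope sesquilinear_scope.
Local Open Scope classical_set_scope.

(** * Adjoints and the spectral splitting of a Hermitian matrix *)

Section Adjoint.
Variable C : numClosedFieldType.

Lemma trmxC_mul m n p (A : 'M[C]_(m, n)) (B : 'M[C]_(n, p)) :
  (A *m B) ^t* = B ^t* *m A ^t*.
Proof. by rewrite trmx_mul map_mxM. Qed.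

Lemma trmxCD m n (A B : 'M[C]_(m, n)) : (A + B) ^t* = A ^t* + B ^t*.
Proof. by rewrite linearD /= map_mxD. Qed.

Lemma trmxCN m n (A : 'M[C]_(m, n)) : (- A) ^t* = - A ^t*.
Proof. by rewrite linearN /= map_mxN. Qed.

Lemma trmxCZ m n a (A : 'M[C]_(m, n)) : (a *: A) ^t* = a^* *: A ^t*.
Proof. by rewrite linearZ /= map_mxZ. Qed.

Lemma hermsymmxP n (A : 'M[C]_n) : reflect (A ^t* = A) (A \is hermsymmx).
Proof.
by apply: (iffP (is_hermitianmxP _ _ _)) => {1}->; rewrite expr0 scale1r ?trmxCK.
Qed.

Lemma skewhermmxP n (A : 'M[C]_n) :
  reflect (A ^t* = - A) (A \is hermitianmx n true Num.conj).
Proof.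
apply: (iffP (is_hermitianmxP _ _ _)); rewrite expr1 scaleN1r => h.
  by rewrite [in RHS]h opprK.
by rewrite h opprK.
Qed.

(** This trace is the sum of the squared moduli of all entries, and a sum of nonnegative terms
    vanishes only termwise. *)
Lemma trace_mul_trmxC_eq0 m n (A : 'M[C]_(m, n)) :
  \tr (A *m A ^t*) = 0 -> A = 0.
Proof.
move=> /eqP; rewrite /mxtrace.
under eq_bigr => i _ do rewrite mxE.
under eq_bigr => i _ do under eq_bigr => j _ do rewrite !mxE -normCK.
have nn i : 0 <= \sum_(j < n) `|A i j| ^+ 2 by apply: sumr_ge0 => j _; rewrite exprn_ge0.
rewrite psumr_eq0 // => /allP h; apply/matrixP => i j; rewrite mxE.
move: (h i (mem_index_enum i)) => /=.
rewrite psumr_eq0; last by move=> k _; rewrite exprn_ge0.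
move=> /allP /(_ j (mem_index_enum j)) /=.
by rewrite expf_eq0 /= normr_eq0 => /eqP.
Qed.

(* In an eigenbasis of [rho], a commutator [X, rho] has entries
   X_ij (d_j - d_i): it reaches exactly the entries with d_i <> d_j, and the
   remaining ones commute with [rho]. *)
Lemma hermitian_commutator_split n (rho v : 'M[C]_n) :
  rho \is hermsymmx -> v \is hermsymmx ->
  exists X : 'M[C]_n, exists u : 'M[C]_n,
    [/\ X \is hermitianmx n true Num.conj, u \is hermsymmx,
        u *m rho = rho *m u & v = X *m rho - rho *m X + u].
Proof.
move=> rhoH /hermsymmxP vH.
have /orthomx_spectralP := hermitian_normalmx rhoH.
have /mxOverP dR := hermitian_spectral_diag_real rhoH.
have PU := spectral_unitarymx rho.
rewrite (invmx_unitary PU); move: PU dR.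
set P := spectralmx rho; set d := spectral_diag rho => PU dR rhoE.
have PPa : P *m P ^t* = 1%:M by apply/unitarymxP.
have PaP : P ^t* *m P = 1%:M by apply: mulmx1C.
(* [w] is [v] in the eigenbasis of [rho], known only through [wdef], so entrywise rewriting does not
   unfold the product. *)
have [w wdef] : exists w, w = P *m v *m P ^t* by exists (P *m v *m P ^t*).
have wH i j : (w i j)^* = w j i.
  have : w ^t* = w by rewrite wdef !trmxC_mul trmxCK vH mulmxA.
  by move/matrixP/(_ j i); rewrite !mxE.
have dC i : (d 0 i)^* = d 0 i by apply/CrealP.
(* Division by zero yields 0, so [Y] vanishes wherever [d 0 i = d 0 j], in particular on the
   diagonal; [z] collects exactly those entries of [w]. *)
pose Y := \matrix_(i, j) (w i j / (d 0 j - d 0 i)) : 'M[C]_n.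
pose z := \matrix_(i, j) (w i j *+ (d 0 i == d 0 j)) : 'M[C]_n.
have YH : Y ^t* = - Y.
  apply/matrixP => i j; rewrite !mxE rmorphM fmorphV rmorphB /= wH !dC.
  by rewrite -mulrN -invrN opprB.
have zH : z ^t* = z.
  by apply/matrixP => i j; rewrite !mxE rmorphMn /= wH eq_sym.
have zd : z *m diag_mx d = diag_mx d *m z.
  apply/matrixP => i j; rewrite mul_mx_diag mul_diag_mx !mxE mulrC.
  by case: eqVneq => [->|_] //=; rewrite !mulr0n !mulr0.
have wE : w = Y *m diag_mx d - diag_mx d *m Y + z.
  apply/matrixP => i j; rewrite mul_mx_diag mul_diag_mx !mxE.
  rewrite [d 0 i * _]mulrC -mulrBr; case: (eqVneq (d 0 i) (d 0 j)) => [->|dij].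
    by rewrite subrr mulr0 add0r mulr1n.
  by rewrite mulfVK ?addr0 // subr_eq0 eq_sym.
(* Conjugation by the unitary [P] respects products, so the identities for [diag_mx d] carry over to
   [rho]. *)
have cM A B : (P ^t* *m A *m P) *m (P ^t* *m B *m P) = P ^t* *m (A *m B) *m P.
  by rewrite !mulmxA -[P ^t* *m A *m P *m _]mulmxA PPa mulmx1.
exists (P ^t* *m Y *m P), (P ^t* *m z *m P); split.
- by apply/skewhermmxP; rewrite !trmxC_mul trmxCK YH mulNmx mulmxN mulmxA.
- by apply/hermsymmxP; rewrite !trmxC_mul trmxCK zH mulmxA.
- by rewrite rhoE !cM zd.
rewrite rhoE !cM -mulmxBl -mulmxBr -mulmxDl -mulmxDr -wE wdef !mulmxA PaP mul1mx.
by rewrite -mulmxA PaP mulmx1.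
Qed.

End Adjoint.

Local Open Scope complex_scope.

(** * Commutators and the orthogonal decomposition *)

Section Commutator.
Variables (R : realType) (n : nat).
Implicit Types A B X rho : 'M[R[i]]_n.

Lemma tr_commutator A B : \tr (commutator_mx A B) = 0.
Proof. by rewrite raddfB /= mxtrace_mulC subrr. Qed.

(** Invariance of the trace form: by cyclicity, tr(BAD) = tr(ADB). *)
Lemma inner_commutator A B D :
  inner_mx (commutator_mx A B) D = inner_mx A (commutator_mx B D).
Proof.
rewrite /inner_mx /commutator_mx mulmxBl mulmxBr !raddfB /= !mulmxA.
by congr (_ - _); rewrite -[B *m A *m D]mulmxA mxtrace_mulC.
Qed.

Lemma commutator_mxC A B : commutator_mx A B = - commutator_mx B A.
Proof. by rewrite opprB. Qed.

Lemma commutator_linl a A B D :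
  commutator_mx (a *: A + B) D = a *: commutator_mx A D + commutator_mx B D.
Proof.
rewrite /commutator_mx mulmxDl mulmxDr -scalemxAl -scalemxAr scalerBr.
by rewrite opprD addrACA.
Qed.

Lemma commutator_skew_Herm X rho :
  skewHerm X -> Herm rho -> Herm (commutator_mx X rho).
Proof.
move=> /skewhermmxP XH /hermsymmxP rH; apply/hermsymmxP.
by rewrite trmxCD trmxCN !trmxC_mul XH rH mulNmx mulmxN opprK addrC.
Qed.

Lemma conj_real (a : R) : Num.conj (a%:C : R[i]) = a%:C.
Proof. by apply/CrealP/complex_realP; exists a. Qed.

Lemma Herm_lin (a : R) A B : Herm A -> Herm B -> Herm (a%:C *: A + B).
Proof.
move=> /hermsymmxP AH /hermsymmxP BH; apply/hermsymmxP.
by rewrite trmxCD trmxCZ conj_real AH BH.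
Qed.

Lemma skewHerm_lin (a : R) A B :
  skewHerm A -> skewHerm B -> skewHerm (a%:C *: A + B).
Proof.
move=> /skewhermmxP AH /skewhermmxP BH; apply/skewhermmxP.
by rewrite trmxCD trmxCZ conj_real AH BH scalerN opprD.
Qed.

Lemma Rspace_subspace rho : real_subspace (Rspace rho).
Proof.
split=> [|a _ _ [X XH <-] [Y YH <-]].
  exists 0; last by rewrite /commutator_mx mul0mx mulmx0 subrr.
  by apply/skewhermmxP; rewrite trmx0 map_mx0 oppr0.
by exists (a%:C *: X + Y); [exact: skewHerm_lin|exact: commutator_linl].
Qed.

Lemma Cspace_subspace rho : real_subspace (Cspace rho).
Proof.
split=> [|a A B [AH Ac At] [BH Bc Bt]].
  split; [|by rewrite /commutator_mx mul0mx mulmx0 subrr|exact: mxtrace0].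
  by apply/hermsymmxP; rewrite trmx0 map_mx0.
split; first exact: Herm_lin.
- by rewrite commutator_linl Ac Bc scaler0 addr0.
- by rewrite mxtraceD mxtraceZ At Bt mulr0 addr0.
Qed.

(** Invariance moves the commutator onto [u], leaving [X] paired with [rho, u] = 0. *)
Lemma Rspace_Cspace_orthogonal rho : orthogonal_sets (Rspace rho) (Cspace rho).
Proof.
move=> _ u [X _ <-] [_ uc _].
by rewrite inner_commutator commutator_mxC uc /inner_mx oppr0 mulmx0 mxtrace0.
Qed.

Lemma tangent_direct_sum rho : Herm rho ->
  direct_sum (tangent rho) (Rspace rho) (Cspace rho).
Proof.
move=> rH; split; [exact: Rspace_subspace|exact: Cspace_subspace| |].
  apply/seteqP; split=> v.
    move=> [vH vt]; have [X [u [XH uH uc vE]]] := hermitian_commutator_split rH vH.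
    exists (commutator_mx X rho); first by exists X; [exact: XH|].
    exists u; last exact/esym/vE.
    split; [exact: uH|by rewrite /commutator_mx uc subrr|].
    by move: vt; rewrite vE mxtraceD tr_commutator add0r.
  move=> [_ [X XH <-]] [u [uH _ ut] <-]; split.
    rewrite -[commutator_mx X rho]scale1r.
    exact: Herm_lin (commutator_skew_Herm XH rH) uH.
  by rewrite mxtraceD tr_commutator ut addr0.
apply/seteqP; split=> [A [RA CA]|_ ->].
  have AA := Rspace_Cspace_orthogonal RA CA; have [/hermsymmxP AH _ _] := CA.
  by apply: trace_mul_trmxC_eq0; rewrite AH.
by split; [case: (Rspace_subspace rho)|case: (Cspace_subspace rho)].
Qed.

End Commutator.

(** * Real functions with zero derivative relative to an interval *)

Section Derivative.
Variable R : realType.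

(** The mean value theorem needs a two-sided derivative inside and continuity up to the ends. Both
    follow from the local bound [fE], which only concerns points of [I]. *)
Lemma zero_derivative_in_constant (I : interval R) (f : R -> R) :
  (forall t, t \in I -> (s - t)^-1 * (f s - f t) @[s --> within [set` I] t^'] --> 0) ->
  forall s t, s \in I -> t \in I -> f s = f t.
Proof.
move=> fD.
have fE t e : t \in I -> 0 < e ->
    \forall s \near t, s \in I -> `|f t - f s| <= e * `|t - s|.
  move=> tI e0; move/cvgrPdist_le: (fD t tI) => /(_ e e0).
  rewrite !near_withinE.
  apply: filterS => s hs sI.
  have [->|st] := eqVneq s t; first by rewrite !subrr normr0 mulr0.
  move: (hs st sI); rewrite sub0r normrN normrM normfV mulrC ler_pdivrMr.
    by rewrite distrC [`|s - t|]distrC.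
  by rewrite normr_gt0 subr_eq0.
have f_cont t e : t \in I -> 0 < e ->
    \forall s \near t, s \in I -> `|f t - f s| < e.
  move=> tI e0; near=> s => sI.
  (* The bound [fE] with constant 1 already gives continuity relative to [I]. *)
  have /le_lt_trans : `|f t - f s| <= 1 * `|t - s|.
    by move: sI; near: s; exact: fE.
  apply; rewrite mul1r; near: s.
  by move/cvgrPdist_lt: (@cvg_id _ (nbhs t)); apply.
suff lst s t : s < t -> s \in I -> t \in I -> f s = f t.
  move=> s t sI tI; case: (ltgtP s t) => [st|ts|-> //]; first exact: lst.
  by apply/esym/lst.
move=> st sI tI.
have stI x : s <= x -> x <= t -> x \in I.
  move=> sx xt; apply: (@interval_is_interval _ I s t sI tI x).
  by rewrite sx.
(* Strictly between [s] and [t], all nearby points lie in [I], so the relative derivative is an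
   ordinary one. *)
have fd x : x \in `]s, t[%R -> is_derive x (1 : R) f 0.
  rewrite in_itv /= => /andP[sx xt]; have xI := stI x (ltW sx) (ltW xt).
  have : h^-1 *: (f (h *: 1 + x) - f x) @[h --> 0^'] --> (0 : R).
    apply/cvgrPdist_le => e e0.
    have addx : h + x @[h --> (0:R)] --> x.
      by rewrite -[X in _ --> X]add0r; apply: cvgD; [exact: cvg_id|exact: cvg_cst].
    rewrite near_withinE.
    near=> h => h0.
    rewrite sub0r normrN normrZ normfV mulrC ler_pdivrMr ?normr_gt0 //.
    rewrite /GRing.scale /= mulr1 distrC.
    have -> : `|h| = `|x - (h + x)| by rewrite opprD addrCA subrr addr0 normrN.
    have : h + x \in I.
      apply: stI; apply: ltW; near: h.
        exact: (addx (fun y => s < y) (lt_nbhsr sx)).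
      exact: (addx (fun y => y < t) (lt_nbhsl xt)).
    near: h.
    exact: (addx (fun y => y \in I -> `|f x - f y| <= e * `|x - y|) (fE x e xI e0)).
  move=> c; apply: DeriveDef; first by apply/cvg_ex; exists 0.
  exact: cvg_lim c.
(* At [s] and [t] only one-sided continuity is required; the points approaching from inside belong
   to [I]. *)
have fc : {within `[s, t], continuous f}.
  apply/continuous_within_itvP => //; split.
  - move=> x xst; have [+ _] := fd x xst.
    by move=> /derivable1_diffP /differentiable_continuous.
  - apply/cvgrPdist_lt => e e0; near=> x.
    have : x \in I by apply: stI => //; near: x; exact: nbhs_right_le.
    by near: x; apply: cvg_within; exact: f_cont.
  - apply/cvgrPdist_lt => e e0; near=> x.
    have : x \in I by apply: stI => //; near: x; exact: nbhs_left_ge.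
    by near: x; apply: cvg_within; exact: f_cont.
have [c _] := MVT st fd fc.
by rewrite mul0r => /eqP; rewrite subr_eq0 => /eqP.
Unshelve. all: by end_near. Qed.

(** The real part is 1-Lipschitz, since |Re z| <= |z|. *)
Lemma cvg_Re (T : Type) (F : set_system T) (FF : Filter F)
    (g : T -> R[i]^o) (l : R[i]^o) :
  g @ F --> l -> complex.Re (g x) @[x --> F] --> complex.Re l.
Proof.
move=> gl; apply/cvgrPdist_lt => e e0.
have e0C : 0 < (e%:C : R[i]^o) by rewrite ltcR.
move/cvgrPdist_lt: gl => /(_ _ e0C); apply: filterS => x.
rewrite -raddfB -ltcR; apply: le_lt_trans; exact: normc_ge_Re.
Qed.

End Derivative.

(** * The trace along a path *)

Lemma Re_mul_real (R : realType) (a : R) (z : R[i]) :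
  complex.Re (a%:C * z) = a * complex.Re z.
Proof. by case: z => x y; rewrite /= mul0r subr0. Qed.

Lemma mxtrace_continuous (K : numFieldType) n :
  continuous (fun A : 'M[K]_n => \tr A).
Proof.
apply: (@continuous_big _ _ (+%R : K -> K -> K)) => [|i _].
  exact: add_continuous.
exact: coord_continuous.
Qed.

(** The conjugate of the trace is the trace of the adjoint. *)
Lemma Herm_trace_real (R : realType) n (A : 'M[R[i]]_n) :
  Herm A -> \tr A \is Num.real.
Proof.
move=> /hermsymmxP AH; apply/CrealP; rewrite -[in RHS]AH.
by rewrite /mxtrace rmorph_sum; apply: eq_bigr => i _; rewrite !mxE.
Qed.

Theorem proposition1 (R : realType) (n : nat) (n_ge1 : (1 <= n)%N) :
  (forall rho : 'M[R[i]]_n, density rho ->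
     direct_sum (tangent rho) (Rspace rho) (Cspace rho) /\
     orthogonal_sets (Rspace rho) (Cspace rho)) /\
  (forall (I : interval R) (rho X u : R -> 'M[R[i]]_n),
     (forall t : R, t \in I -> HermPos (rho t)) ->
     (forall t : R, t \in I ->
        has_derivative_in I rho t (commutator_mx (X t) (rho t) + u t)) ->
     (forall t : R, t \in I -> skewHerm (X t)) ->
     (forall t : R, t \in I -> Cspace (rho t) (u t)) ->
     forall s t : R, s \in I -> t \in I -> \tr (rho s) = \tr (rho t)).
Proof.
split=> [rho [[rH _] _]|I rho X u rP rD XS uC].
  by split; [exact: tangent_direct_sum|exact: Rspace_Cspace_orthogonal].
(* The trace is recovered from its real part, a real function to which the mean value argument
   applies. *)
have trR t : t \in I -> (complex.Re (\tr (rho t)))%:C = \tr (rho t).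
  by move=> tI; apply: RRe_real; apply: Herm_trace_real; have [] := rP t tI.
move=> s t sI tI; rewrite -(trR s sI) -(trR t tI); congr (_%:C).
apply: (zero_derivative_in_constant (I := I)
  (f := fun t => complex.Re (\tr (rho t)))) => // {sI tI s}t tI.
have [_ _ ut] := uC t tI.
have trD : complex.Re (\tr (((s - t)^-1)%:C *: (rho s - rho t)))
    @[s --> within [set` I] t^'] --> (0 : R).
  (* The limit is 0 because both the commutator and [u t] are traceless; continuity of the trace and
     of [Re] then transports the matrix limit. *)
  have -> : 0 = complex.Re (\tr (commutator_mx (X t) (rho t) + u t)).
    by rewrite mxtraceD tr_commutator ut addr0.
  apply: cvg_Re.
  exact: cvg_comp (rD t tI) (@mxtrace_continuous R[i]^o n _).
rewrite (_ : (fun s : R => _) =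
    (fun s : R => complex.Re (\tr (((s - t)^-1)%:C *: (rho s - rho t))))) //.
by apply/funext => s; rewrite mxtraceZ Re_mul_real !raddfB.
Qed.
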